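(* For every integer $q\ge 3$ and every integer $k\ge 0$, $$M\bigl(H(q,2k+1)\bigr)=\left\lfloor\frac{q^{k+1}}{\lfloor q/2\rfloor+1}\right\rfloor .$$
   Context: All graphs are finite and simple. For a graph $G$, a vertex $v$ of $G$ and $S\subseteq V(G)$, put $d_S(v)=|N_G(v)\cap S|$, and let $d_G(v)$ be the degree of $v$ in $G$. A nonempty set $S\subseteq V(G)$ is a majority class if $d_S(v)\ge\lceil d_G(v)/2\rceil$ for every $v\in S$. A majority C-colouring of $G$ is a partition of $V(G)$ into majority classes, and $M(G)$ denotes the largest possible number of parts in such a partition. $\square$ denotes the Cartesian product of graphs, and $H(q,D)=K_q^{\square D}$ is the $D$-fold Cartesian power of the complete graph $K_q$ (vertices: $D$-tuples over a $q$-element alphabet, two being adjacent iff they differ in exactly one coordinate), with $H(q,0)=K_1$. *)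

(* Defs.v *)
From mathcomp Require Import all_boot.

Set Implicit Arguments.
Unset Strict Implicit.
Unset Printing Implicit Defensive.

Record sgraph := SGraph {
  vertex :> finType;
  adj : rel vertex;
  adj_sym : symmetric adj;
  adj_irrefl : irreflexive adj
}.

Section MajorityColouring.

Variable G : sgraph.
Implicit Types (v : G) (S : {set G}) (P : {set {set G}}).

Definition neighbours v : {set G} := [set w | adj v w].

Definition degree v : nat := #|neighbours v|.

Definition degree_in S v : nat := #|neighbours v :&: S|.

(* [uphalf d] is the ceiling of d / 2. *)
Definition majority_class S : bool :=
  (S != set0) && [forall v in S, uphalf (degree v) <= degree_in S v].

Definition majority_C_colouring P : bool :=
  partition P [set: G] && [forall S in P, majority_class S].

(* The [\max] over an empty range is 0, but this range is never empty: see
   [majority_C_colouring_ex]. *)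
Definition majority_number : nat :=
  \max_(P : {set {set G}} | majority_C_colouring P) #|P|.

Lemma majority_C_colouring_ex : exists P, majority_C_colouring P.
Proof.
have [G0|[v _]] := set_0Vmem [set: G].
  exists set0; rewrite /majority_C_colouring G0 partition_set0 eqxx /=.
  by apply/forall_inP => S; rewrite inE.
exists [set [set: G]]; apply/andP; split.
  rewrite /partition /cover big_set1 eqxx trivIset1 in_set1 eq_sym.
  by apply/set0Pn; exists v.
apply/forall_inP => S /set1P ->; apply/andP; split.
  by apply/set0Pn; exists v.
apply/forall_inP => w _; rewrite /degree_in setIT /degree.
by rewrite leq_uphalf_double -addnn leq_addr.
Qed.

End MajorityColouring.

(* The [D]-tuples over the alphabet ['I_q] are the finite functions from ['I_D]
   to ['I_q]. *)
Definition hamming_adj (q D : nat) : rel {ffun 'I_D -> 'I_q} :=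
  fun x y => #|[set i | x i != y i]| == 1.

Lemma hamming_adj_sym q D : symmetric (@hamming_adj q D).
Proof.
move=> x y; rewrite /hamming_adj; congr (_ == _).
by apply: eq_card => i; rewrite !inE eq_sym.
Qed.

Lemma hamming_adj_irrefl q D : irreflexive (@hamming_adj q D).
Proof.
move=> x; rewrite /hamming_adj eq_card0 // => i.
by rewrite !inE eqxx.
Qed.

Definition hamming (q D : nat) : sgraph :=
  SGraph (@hamming_adj_sym q D) (@hamming_adj_irrefl q D).

(* Main.v *)
(** Put [m = q %/ 2]; every vertex of [H(q, 2k+1)] needs [k(q-1) + m] neighbours
in its class.

Upper bound: a nonempty set [S] of minimum degree at least [k(q-1) + r], with
[r < q], has at least [q^k (r+1)] elements.  Cut [S] along the first coordinate;
if [t] layers are nonempty, the degree inside each of them drops by at most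
[t-1], and the bound for the layers, multiplied by [t], implies the bound for
[S] by concavity.

Lower bound: in [H(q, k+1)], take away [q^(k+1) %% (m+1)] vertices of a line and
partition the rest into [(m+1)]-cliques; each removed vertex can join a clique
of a line through it, and the [k] further coordinates are left free.  By
induction on the dimension, each of the [q] layers is so partitioned, up to
[r = q^n %% (m+1)] vertices of its line, whose position can be prescribed; these
lines span a [q x q] grid, in which the [q r] remaining vertices are chosen so
as to be covered by cliques transversal to the layers, up to
[q r %% (m+1)] vertices in the first column. *)
Require Import Defs.
From mathcomp Require Import all_boot zify.

Set Implicit Arguments.
Unset Strict Implicit.
Unset Printing Implicit Defensive.

Section Words.

Variable q : nat.
Local Notation word n := (hamming q n).

(** * Splitting words along the first coordinate *)

Definition wcons n (a : 'I_q) (x : word n) : word n.+1 :=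
  [ffun i => oapp x a (unlift ord0 i)].

Definition whead n (x : word n.+1) : 'I_q := x ord0.
Definition wtail n (x : word n.+1) : word n := [ffun i => x (lift ord0 i)].

Lemma wheadK n a (x : word n) : whead (wcons a x) = a.
Proof. by rewrite /whead ffunE unlift_none. Qed.

Lemma wtailK n a : cancel (@wcons n a) (@wtail n).
Proof. by move=> x; apply/ffunP => i; rewrite !ffunE liftK. Qed.

Lemma wconsK n (x : word n.+1) : wcons (whead x) (wtail x) = x.
Proof.
by apply/ffunP => i; rewrite ffunE; case: unliftP => [j|] -> //=; rewrite ffunE.
Qed.

Lemma wcons_injr n a : injective (@wcons n a).
Proof. exact: can_inj (wtailK a). Qed.

Lemma wcons_injl n (x : word n) : injective (@wcons n ^~ x).
Proof. by move=> a b /(congr1 (@whead n)); rewrite !wheadK. Qed.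

Lemma hamming_adj_cons n a b (x y : word n) :
  hamming_adj (wcons a x) (wcons b y) =
    (a == b) && hamming_adj x y || (a != b) && (x == y).
Proof.
have neqE : (x == y) = (#|[set i | x i != y i]| == 0).
  rewrite cards_eq0; apply/eqP/eqP => [->|/setP xy].
    by apply/setP => i; rewrite !inE eqxx.
  by apply/ffunP => i; have := xy i; rewrite !inE => /negbFE/eqP.
rewrite neqE /hamming_adj -!sum1dep_card big_mkcond big_ord_recl /=.
rewrite !ffunE unlift_none /=.
under eq_bigr => i _ do rewrite !ffunE liftK /=.
by rewrite -big_mkcond /=; case: (eqVneq a b) => _ /=; rewrite ?orbF.
Qed.

Lemma degree_in_cons n (S : {set word n.+1}) (a : 'I_q)
    (x : word n) :
  degree_in S (wcons a x) =
    degree_in (@wcons n a @^-1: S) x + #|[set b | b != a & wcons b x \in S]|.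
Proof.
rewrite -(card_imset _ (@wcons_injl n x)) /degree_in.
rewrite -(card_imset (mem (_ :&: _)) (@wcons_injr n a)).
(* Neighbours inside the layer and across layers form disjoint sets, so the union bound is an
   equality; disjointness is proved last. *)
have /leqifP := leq_card_setU (@wcons n a @: (neighbours x :&: @wcons n a @^-1: S))
  ((@wcons n)^~ x @: [set b | b != a & wcons b x \in S]).
case: ifP => [_ /eqP<-|/negP[]].
  apply: eq_card => w; rewrite -(wconsK w) !inE /= hamming_adj_cons andb_orl.
  have im_r (A : {set word n}) :
      (wcons (whead w) (wtail w) \in @wcons n a @: A) =
        (whead w == a) && (wtail w \in A).
    apply/imsetP/andP => [[y Ay wE]|[/eqP-> wA]]; last by exists (wtail w).
    by move/(congr1 (@whead n)): (wE); move/(congr1 (@wtail n)): wE;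
      rewrite !wheadK !wtailK => -> ->.
  have im_l (A : {set 'I_q}) :
      (wcons (whead w) (wtail w) \in (@wcons n)^~ x @: A) =
        (wtail w == x) && (whead w \in A).
    apply/imsetP/andP => [[y Ay wE]|[/eqP-> wA]]; last by exists (whead w).
    by move/(congr1 (@whead n)): (wE); move/(congr1 (@wtail n)): wE;
      rewrite !wheadK !wtailK => -> ->.
  rewrite im_r im_l !inE [a == _]eq_sym [x == _]eq_sym.
  by case: (eqVneq (whead w) a) => [->|] /=; case: (eqVneq (wtail w) x) => [->|];
    rewrite ?andbF ?orbF.
rewrite -setI_eq0; apply/eqP/setP => w; rewrite !inE.
apply/negP => /andP[/imsetP[y _ ->] /imsetP[b]].
rewrite inE => /andP[ba _] /(congr1 (@whead n)); rewrite !wheadK => abE.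
by rewrite abE eqxx in ba.
Qed.

Lemma degree_hamming n (x : word n) : degree x = n * q.-1.
Proof.
rewrite /degree -[neighbours x]setIT -/(degree_in setT x).
elim: n x => [|n IHn] x.
  rewrite /degree_in eq_card0 // => y; rewrite !inE andbT /= /hamming_adj.
  by rewrite eq_card0 // => -[].
rewrite -(wconsK x) degree_in_cons preimsetT IHn mulSn addnC; congr (_ + _).
have -> : [set b | b != whead x & wcons b (wtail x) \in setT] = [set~ whead x].
  by apply/setP => b; rewrite !inE andbT.
by rewrite cardsC1 card_ord.
Qed.

Lemma card_layers n (S : {set word n.+1}) :
  #|S| = \sum_a #|@wcons n a @^-1: S|.
Proof.
rewrite -sum1_card (partition_big (@whead n) xpredT) //=; apply: eq_bigr => a _.
rewrite sum1dep_card -(card_imset _ (@wcons_injr n a)); apply: eq_card => w.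
rewrite inE; apply/andP/imsetP => [[Sw /eqP<-]|[x]].
  by exists (wtail w); rewrite ?inE wconsK.
by rewrite inE => Sx ->; rewrite wheadK.
Qed.


(** * Size of a set of given minimum degree *)

Lemma min_degree_card n k r (S : {set word n}) :
  S != set0 -> r < q ->
  (forall x, x \in S -> k * q.-1 + r <= degree_in S x) ->
  q ^ k * r.+1 <= #|S|.
Proof.
elim: n k r S => [|n IHn] k r S S0 rq Sdeg.
  have [x Sx] := set0Pn _ S0.
  have := Sdeg _ Sx; have := subset_leq_card (subsetIl (neighbours x) S).
  rewrite -/(degree_in S x) -/(degree x) degree_hamming mul0n leqn0 => /eqP->.
  rewrite leqn0 addn_eq0 muln_eq0 => /andP[kq /eqP r0]; subst r.
  rewrite muln1.
  have -> : q ^ k = 1.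
    case/orP: kq => [/eqP-> //|q1]; have -> : q = 1 by lia.
    exact: exp1n.
  by rewrite card_gt0.
pose T := [set a | @wcons n a @^-1: S != set0].
have T0 : 0 < #|T|.
  have [x Sx] := set0Pn _ S0; apply/card_gt0P; exists (whead x).
  by rewrite inE; apply/set0Pn; exists (wtail x); rewrite inE wconsK.
have Tq : #|T| <= q by rewrite -[X in _ <= X]card_ord max_card.
have layer_deg a x : x \in @wcons n a @^-1: S ->
    k * q.-1 + r <= degree_in (@wcons n a @^-1: S) (x : word n) + #|T|.-1.
  rewrite inE => Sx; apply: leq_trans (Sdeg _ Sx) _.
  rewrite degree_in_cons leq_add2l.
  have aT : a \in T by rewrite inE; apply/set0Pn; exists x; rewrite inE.
  rewrite [#|T|](cardsD1 a) aT /=; apply/subset_leq_card/subsetP => b.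
  by rewrite !inE => /andP[-> Sb]; apply/set0Pn; exists x; rewrite inE.
suff [f fle ft] : exists2 f, forall a, a \in T -> f <= #|@wcons n a @^-1: S|
    & q ^ k * r.+1 <= #|T| * f.
  apply: leq_trans ft _; rewrite card_layers -sum_nat_const.
  rewrite [X in _ <= X](bigID (mem T)) /= -[X in X <= _]addn0.
  by rewrite leq_add // leq_sum.
(* With t = [#|T|] <= r + 1, the last inequality amounts to (t - 1)(r + 1 - t) >= 0. *)
have [tr|rt] := leqP #|T|.-1 r.
  exists (q ^ k * (r - #|T|.-1).+1).
    move=> a; rewrite inE => Sa; apply: IHn => // [|x /layer_deg]; lia.
  rewrite mulnCA leq_mul2l; apply/orP; right; nia.
case: k Sdeg layer_deg => [|k] _ layer_deg.
  exists 1; last by lia.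
  by move=> a; rewrite inE card_gt0.
(* Now t > r + 1: one unit of [k] is exchanged for q - 1 units of remainder, and (t - r - 1)(q - t)
   >= 0 concludes. *)
exists (q ^ k * (q.-1 + r - #|T|.-1).+1).
  move=> a; rewrite inE => Sa; apply: IHn => // [|x /layer_deg]; first by lia.
  by rewrite mulSn; lia.
rewrite mulnCA expnSr -mulnA leq_mul2l; apply/orP; right; nia.
Qed.


(** * Partition into cliques *)

(* [E i] is the set of columns used in row [i] of the grid.  Deal the [q r]
   incidences out to the rows cyclically, the rows of [R] coming first, and
   cut the resulting sequence into column [0], of length [#|R|], followed by
   columns of length [m+1]: each column has distinct rows because [m < q]. *)
Lemma cyclic_incidence (z : 'I_q) m r (R : {set 'I_q}) :
  val z = 0 -> r <= m < q -> #|R| = q * r %% m.+1 ->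
  exists E : 'I_q -> {set 'I_q},
    [/\ forall i, #|E i| = r,
        forall i, i \in R -> z \in E i &
        forall u : 'I_q, 0 < u <= q * r %/ m.+1 ->
          m < #|[set i | u \in E i]|].
Proof.
move=> z0 /andP[rm mq] Rcard.
pose s := enum R ++ enum (~: R); pose pos i := index i s.
have s_mem i : i \in s by rewrite mem_cat !mem_enum inE orbN.
have s_uniq : uniq s.
  rewrite cat_uniq !enum_uniq andbT; apply/hasPn => i.
  by rewrite !mem_enum inE.
have s_size : size s = q by rewrite size_cat -!cardE cardsC card_ord.
have pos_lt i : pos i < q by rewrite -s_size index_mem.
set M := q * r %/ m.+1.
have qrE : q * r = M * m.+1 + #|R| by rewrite Rcard -divn_eq.
have R_le : #|R| <= m by rewrite Rcard -ltnS ltn_mod.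
have M_lt : M < q.
  by rewrite /M ltn_divLR // ltn_mul2l ltnS rm andbT; apply: leq_trans mq.
(* The shift makes column [0] exactly [#|R|] long. *)
pose col t := (t + (m.+1 - #|R|)) %/ m.+1.
have col_lt t : t < q * r -> col t < q.
  move=> tqr; apply: leq_trans M_lt; rewrite ltnS -ltnS /col ltn_divLR //.
  by rewrite mulSn; lia.
have slot_lt i (l : 'I_r) : pos i + l * q < q * r.
  have := pos_lt i; have := ltn_ord l; nia.
(* Column of the [l]-th incidence of row [i]; it is below [q], so the default [z] is never taken. *)
pose h i (l : 'I_r) := insubd z (col (pos i + l * q)).
have hE i l : val (h i l) = col (pos i + l * q).
  by rewrite val_insubd col_lt.
exists (fun i => [set h i l | l : 'I_r]); split.
- move=> i; rewrite card_imset ?card_ord // => l l' /(congr1 val).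
  rewrite !hE /col => colE; apply/val_inj => /=.
  (* Incidences of one row are at least q >= m + 1 places apart, so their columns differ. *)
  have step (a b : 'I_r) : a < b ->
      (pos i + a * q + (m.+1 - #|R|)) %/ m.+1 <
        (pos i + b * q + (m.+1 - #|R|)) %/ m.+1.
    move=> ab; apply: (@leq_trans
      ((pos i + a * q + (m.+1 - #|R|) + m.+1) %/ m.+1)).
      by rewrite [X in _ < X]divnDr // divnn addn1.
    by apply: leq_div2r; nia.
  by case: (ltngtP l l') => // /step; rewrite colE ltnn.
- move=> i Ri; have r_gt0 : 0 < r.
    have : 0 < #|R| by apply/card_gt0P; exists i.
    by rewrite Rcard; case: (r) => //; rewrite muln0 mod0n.
  apply/imsetP; exists (Ordinal r_gt0) => //; apply/val_inj.
  rewrite hE z0 /col mul0n addn0 divn_small //.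
  have : pos i < #|R|.
    by rewrite /pos index_cat mem_enum Ri cardE index_mem mem_enum.
  lia.
move=> u /andP[u_gt0 uM].
(* The m + 1 consecutive places of column [u]; the subtraction is exact because u > 0. *)
pose t (j : 'I_m.+1) := u * m.+1 - (m.+1 - #|R|) + j.
have t_lt j : t j < q * r by rewrite /t; have := ltn_ord j; nia.
pose g j := nth z s (t j %% q).
have tq j : t j %% q < size s by rewrite s_size ltn_mod; lia.
have g_inj : injective g.
  move=> j j' /eqP; rewrite nth_uniq // => /eqP.
  have := ltn_ord j; have := ltn_ord j'; rewrite /t => j'm jm.
  move/eqP; rewrite eqn_modDl !modn_small; try lia.
  by move/eqP/val_inj.
rewrite -[m.+1]card_ord -(card_imset _ g_inj); apply/subset_leq_card/subsetP.
move=> _ /imsetP[j _ ->]; rewrite inE.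
have l_lt : t j %/ q < r by rewrite ltn_divLR 1?mulnC //; lia.
apply/imsetP; exists (Ordinal l_lt) => //; apply/val_inj.
rewrite hE /pos /g index_uniq // addnC -divn_eq /col /t /=.
have -> : u * m.+1 - (m.+1 - #|R|) + j + (m.+1 - #|R|) = u * m.+1 + j by nia.
by rewrite divnMDl // divn_small ?addn0.
Qed.

Lemma degree_in_subset n (S T : {set word n}) x :
  S \subset T -> degree_in S x <= degree_in T x.
Proof. by move=> ST; apply/subset_leq_card/setIS. Qed.

(** The leftover vertices, on the line through the all-[z] word, at prescribed positions. *)
Definition spine z n (R : {set 'I_q}) : {set word n.+1} :=
  [set w | (wtail w == [ffun=> z]) && (whead w \in R)].

(* The vertices of the spine are labelled too, with the label of a clique that
   they extend; discounting the spine in the degree makes the property survive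
   when spine vertices are relabelled in the next dimension. *)
Lemma spined_labelling (z : 'I_q) m n (R : {set 'I_q}) :
  val z = 0 -> 0 < m < q -> q <= m.*2.+1 -> #|R| = q ^ n.+1 %% m.+1 ->
  exists c : word n.+1 -> nat,
    [/\ forall x, c x < q ^ n.+1 %/ m.+1,
        forall u, u < q ^ n.+1 %/ m.+1 -> exists x, c x = u &
        forall x, m <= degree_in ([set y | c y == c x] :\: spine z n R) x].
Proof.
move=> z0 /andP[m0 mq] qm.
elim: n R => [|n IHn] R Rcard.
  (* Since m < q <= 2m + 1, there is a single label, and the complement of [R] is a clique of m + 1
     vertices. *)
  have N1 : q ^ 1 %/ m.+1 = 1.
    rewrite expn1 -[q](subnKC mq) -{1}[m.+1]mul1n divnMDl //.
    by rewrite divn_small //; lia.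
  have Rcard' : #|R| = q - m.+1.
    by rewrite Rcard expn1 -{1}(subnK mq) modnDr modn_small //; lia.
  exists (fun=> 0); rewrite N1; split=> // [[|//] _|x].
    by exists [ffun=> z].
  rewrite -(wconsK x) degree_in_cons; apply: leq_trans (leq_addl _ _).
  apply: (@leq_trans #|~: R :\ whead x|).
    have RC : #|~: R| = m.+1 by have := cardsC R; rewrite card_ord; lia.
    by rewrite -ltnS -RC (cardsD1 (whead x)) -[X in _ <= X]add1n leq_add2r leq_b1.
  apply/subset_leq_card/subsetP => b; rewrite !inE wheadK => /andP[-> bR].
  by rewrite (negbTE bR) andbF.
set N := q ^ n.+1 %/ m.+1; set r := q ^ n.+1 %% m.+1.
set M := q * r %/ m.+1.
have r_le : r <= m by rewrite -ltnS ltn_mod.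
have qE : q ^ n.+2 = q * N * m.+1 + q * r.
  by rewrite expnS (divn_eq (q ^ n.+1) m.+1) -/N -/r mulnDr mulnA.
have NE : q ^ n.+2 %/ m.+1 = q * N + M by rewrite qE divnMDl.
have {}Rcard : #|R| = q * r %% m.+1 by rewrite Rcard qE modnMDl.
have M_lt : M < q.
  by rewrite /M ltn_divLR // ltn_mul2l ltnS r_le andbT; lia.
have rmq : r <= m < q by rewrite r_le.
have [E [Ecard ER Ecol]] := cyclic_incidence z0 rmq Rcard.
have /fin_all_exists[c cP] i := IHn (E i) (Ecard i).
have c_lt i x : c i x < N by have [+ _ _] := cP i; apply.
(* Grid vertices in columns 1 to [M] used by their row move to the transversal clique of their
   column; the new spine lies in column 0 and keeps its old labels. *)
pose new (i : 'I_q) (x : word n.+1) :=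
  [&& wtail x == [ffun=> z], whead x \in E i & 0 < (whead x : nat) <= M].
pose c' (w : word n.+2) := if new (whead w) (wtail w)
  then q * N + (whead (wtail w)).-1
  else whead w * N + c (whead w) (wtail w).
have c'_cons i x : c' (wcons i x) =
    if new i x then q * N + (whead x).-1 else i * N + c i x.
  by rewrite /c' wheadK wtailK.
have old_lt (i : 'I_q) x : i * N + c i x < q * N.
  by have := c_lt i x; have := ltn_ord i; nia.
have not_new i x : x \notin spine z n (E i) -> new i x = false.
  by rewrite /new inE; case: (_ == _) => //= /negbTE->.
exists c'; rewrite NE; split.
- move=> w; rewrite /c'; case: ifP => [/and3P[_ _]|_]; first by lia.
  by apply: leq_trans (old_lt _ _) (leq_addr _ _).
- move=> u; have [uqN _|qNu uM] := ltnP u (q * N).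
    have N0 : 0 < N by case: (N) uqN => //; rewrite muln0.
    have i_lt : u %/ N < q by rewrite ltn_divLR.
    pose i := Ordinal i_lt; have [_ csurj cdeg] := cP i.
    have [x cx] := csurj _ (ltn_pmod u N0).
    (* [x] itself may be relabelled, but a neighbour off the spine has the same label and keeps
       it. *)
    have /card_gt0P[y] := leq_trans m0 (cdeg x).
    rewrite !inE => /andP[_ /andP[y_old /eqP cy]].
    exists (wcons i y); rewrite c'_cons not_new ?inE // cy cx /=.
    by rewrite -divn_eq.
  have v_lt : (u - q * N).+1 < q by lia.
  pose v := Ordinal v_lt.
  have /card_gt0P[i] : 0 < #|[set i | v \in E i]|.
    by apply: leq_trans (Ecol v _); rewrite //= -/M; lia.
  rewrite inE => vE; exists (wcons i (wcons v [ffun=> z])).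
  rewrite c'_cons /new wheadK wtailK eqxx vE /= ifT; lia.
move=> w; rewrite -(wconsK w); move: (whead w) (wtail w) => i x.
rewrite degree_in_cons c'_cons; have [x_new|x_old] := boolP (new i x).
  apply: leq_trans (leq_addl _ _).
  have /and3P[/eqP x_tl x_hd x_M] := x_new.
  have := Ecol _ x_M; rewrite (cardsD1 i) inE x_hd add1n ltnS => /leq_trans.
  apply; apply/subset_leq_card/subsetP => b; rewrite !inE => /andP[-> bE].
  rewrite c'_cons wtailK /= /new x_tl eqxx bE x_M eqxx andbT /=.
  apply/negP => /andP[/eqP/ffunP/(_ ord0)]; rewrite !ffunE.
  by move: x_M; rewrite /whead => /[swap] ->; rewrite z0.
(* Neighbours off the layer's spine keep their labels, and that spine contains the part of the new
   one in this layer. *)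
apply: leq_trans (leq_addr _ _); have [_ _ cdeg] := cP i.
apply: leq_trans (cdeg x) _; apply/degree_in_subset/subsetP => y.
rewrite !inE => /andP[y_sp /eqP cyx].
rewrite c'_cons wtailK wheadK not_new ?inE // cyx eqxx andbT.
apply: contra y_sp => /andP[/eqP-> iR]; rewrite /whead ffunE ER // andbT.
by apply/eqP/ffunP => j; rewrite !ffunE.
Qed.

(** Labels that ignore a coordinate gain all [q.-1] neighbours along it. *)
Lemma labelling_free_coordinates n k d N (c : word n -> nat) :
  0 < q -> (forall x, c x < N) -> (forall u, u < N -> exists x, c x = u) ->
  (forall x, d <= degree_in [set y | c y == c x] x) ->
  exists c' : word (k + n) -> nat,
    [/\ forall x, c' x < N,
        forall u, u < N -> exists x, c' x = u &
        forall x, k * q.-1 + d <= degree_in [set y | c' y == c' x] x].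
Proof.
move=> q0 c_lt c_surj c_deg; elim: k => [|k [c' [c'_lt c'_surj c'_deg]]].
  by exists c.
exists (c' \o @wtail (k + n)); split=> [x|u /c'_surj[x <-]|x] //=.
  by exists (wcons (Ordinal q0) x); rewrite wtailK.
rewrite -(wconsK x); move: (whead x) (wtail x) => a {}x.
rewrite degree_in_cons wtailK mulSn -addnA addnC leq_add //.
  apply: leq_trans (c'_deg x) _; apply/degree_in_subset/subsetP.
  by move=> y; rewrite !inE wtailK.
rewrite -{1}[q]card_ord -(cardsC1 a); apply/subset_leq_card/subsetP => b.
by rewrite !inE wtailK eqxx andbT.
Qed.

End Words.

(** * Bounds on the majority number *)

Lemma majority_number_ge (G : sgraph) N (c : G -> nat) :
  (forall x, c x < N) -> (forall u, u < N -> exists x, c x = u) ->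
  (forall x, uphalf (degree x) <= degree_in [set y | c y == c x] x) ->
  N <= majority_number G.
Proof.
move=> c_lt c_surj c_deg.
pose F (u : 'I_N) := [set x | c x == u]; pose P := F @: setT.
have F0 u : F u != set0.
  by have [x cx] := c_surj _ (ltn_ord u); apply/set0Pn; exists x; rewrite inE cx.
have P0 : set0 \notin P by apply/imsetP => -[u _ /esym/eqP]; rewrite (negbTE (F0 u)).
have disj (u v : 'I_N) :
    u \in setT -> v \in setT -> v != u -> [disjoint F u & F v].
  move=> _ _ vu; rewrite -setI_eq0; apply/eqP/setP => x; rewrite !inE.
  by apply: contraNF vu => /andP[/eqP-> /eqP/val_inj->].
have [Ptriv F_inj] := trivIimset disj P0.
have {F_inj} Pcard : #|P| = N by rewrite card_in_imset // cardsT card_ord.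
rewrite -{1}Pcard; apply: leq_bigmax_cond; apply/andP; split.
  rewrite /partition Ptriv P0 !andbT; apply/eqP/setP => x; rewrite inE.
  by apply/bigcupP; exists (F (Ordinal (c_lt x))); rewrite ?imset_f // inE.
apply/forall_inP => _ /imsetP[u _ ->]; rewrite /majority_class F0 /=.
apply/forall_inP => x; rewrite inE => /eqP cx; apply: leq_trans (c_deg x) _.
by rewrite /F -cx.
Qed.

Lemma majority_number_le (G : sgraph) s :
  0 < s -> (forall S : {set G}, majority_class S -> s <= #|S|) ->
  majority_number G <= #|G| %/ s.
Proof.
move=> s0 s_le; apply/bigmax_leqP => P /andP[Ppart /forall_inP Pmaj].
rewrite leq_divRL // -cardsT (card_partition Ppart) -sum_nat_const.
by apply: leq_sum => S /Pmaj; apply: s_le.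
Qed.

Theorem theorem1 (q k : nat) (hq : 3 <= q) :
  majority_number (hamming q (2 * k + 1)) = q ^ (k + 1) %/ (q %/ 2 + 1).
Proof.
(* The ceiling of (q - 1) / 2 is [q %/ 2]. The dimension is a variable because it occurs below in
   two forms. *)
have halfE n (x : hamming q n) : n = 2 * k + 1 ->
    uphalf (degree x) = k * q.-1 + q %/ 2.
  by move=> nE; rewrite degree_hamming nE uphalfE; nia.
rewrite !addn1; apply/eqP; rewrite eqn_leq; apply/andP; split.
  (* Multiplying both terms by [q ^ k] gives the number of vertices over the least class size
     allowed by [min_degree_card]. *)
  have -> : q ^ k.+1 %/ (q %/ 2).+1 =
      #|hamming q (2 * k).+1| %/ (q ^ k * (q %/ 2).+1).
    rewrite card_ffun !card_ord -(@divnMl (q ^ k)) ?expn_gt0; last by lia.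
    by rewrite -expnD; congr (q ^ _ %/ _); lia.
  apply: majority_number_le => [|S /andP[S0 /forall_inP Sdeg]].
    by rewrite muln_gt0 expn_gt0; lia.
  apply: min_degree_card => // [|x Sx]; first by lia.
  by rewrite -(halfE _ x) ?Sdeg //; lia.
have q0 : 0 < q by lia.
have r_le : q ^ k.+1 %% (q %/ 2).+1 <= q.
  by apply: leq_trans (_ : (q %/ 2).+1 <= _); [rewrite ltnW // ltn_mod | lia].
pose R := [set widen_ord r_le j | j : 'I_(q ^ k.+1 %% (q %/ 2).+1)].
have Rcard : #|R| = q ^ k.+1 %% (q %/ 2).+1.
  by rewrite card_imset ?card_ord // => i j /(congr1 val) /= /val_inj.
have m_bounds : 0 < q %/ 2 < q by lia.
have q_le : q <= (q %/ 2).*2.+1 by lia.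
have [c [c_lt c_surj c_deg]] :=
  spined_labelling (z := Ordinal q0) erefl m_bounds q_le Rcard.
have c_deg' x : q %/ 2 <= degree_in [set y | c y == c x] x.
  by apply: leq_trans (c_deg x) _; apply/degree_in_subset/subsetDl.
have [c' [c'_lt c'_surj c'_deg]] :=
  labelling_free_coordinates k q0 c_lt c_surj c_deg'.
have -> : (2 * k).+1 = k + k.+1 by lia.
apply: (majority_number_ge c'_lt c'_surj) => x.
by rewrite halfE ?c'_deg //; lia.
Qed.
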